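(* Let $\mathcal W$ be a discrete memoryless channel from a finite set $\mathcal X$ to a finite set $\mathcal Y$. Then $$E^{\rm NS}_0(\mathcal W)=E^{\rm NS}(0^+,\mathcal W)=E_{\rm sp}(0^+,\mathcal W)=U(\mathcal W),$$ with equalities in $[0,+\infty]$.
   Context: For probability distributions $P,Q$ on a finite set, $D(P\|Q)=\sum_x P(x)\log\frac{P(x)}{Q(x)}$ (with $0\log(0/q)=0$, and $D(P\|Q)=+\infty$ if $P$ is not absolutely continuous w.r.t. $Q$). For $\alpha\in(0,1)\cup(1,\infty)$, the Rényi divergence is $D_\alpha(P\|Q)=\frac{1}{\alpha-1}\log\sum_{x:P(x)>0}P(x)^\alpha Q(x)^{1-\alpha}$ (equal to $+\infty$ if $\alpha>1$ and $P\not\ll Q$). A discrete memoryless channel $\mathcal W$ from $\mathcal X$ to $\mathcal Y$ is a stochastic matrix $(\mathcal W(y|x))_{x,y}$; $\mathcal W^{\times n}(y^n|x^n)=\prod_{i=1}^n\mathcal W(y_i|x_i)$. For $P_X\in\mathcal P(\mathcal X)$ write $P_{XY}(x,y)=P_X(x)\mathcal W(y|x)$. The channel umlaut information is $U(\mathcal W)=\max_{P_X\in\mathcal P(\mathcal X)}\min_{Q_Y\in\mathcal P(\mathcal Y)}D(P_X\times Q_Y\|P_{XY})$. Non-signalling (NS) codes: for message set $[M]=\{1,\dots,M\}$ and a channel $\mathcal W$ from $\mathcal X$ to $\mathcal Y$, an NS code is a conditional distribution $\mathcal Z(x,\hat w\mid y,w)$ ($x\in\mathcal X,\hat w\in[M],y\in\mathcal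 Y,w\in[M]$) such that $\sum_x\mathcal Z(x,\hat w\mid y,w)$ does not depend on $w$ and $\sum_{\hat w}\mathcal Z(x,\hat w\mid y,w)$ does not depend on $y$. Its error probability with a uniformly distributed message is $1-\frac1M\sum_{w\in[M]}\sum_{x,y}\mathcal W(y|x)\mathcal Z(x,w\mid y,w)$, and $\epsilon^{\rm NS}(M,\mathcal W)$ is the minimum of this over all NS codes. Define $E^{\rm NS}(r,\mathcal W)=\liminf_{n\to\infty}-\frac1n\log\epsilon^{\rm NS}(\lceil e^{rn}\rceil,\mathcal W^{\times n})$, $E^{\rm NS}(0^+,\mathcal W)=\liminf_{r\to0^+}E^{\rm NS}(r,\mathcal W)$, and $E^{\rm NS}_0(\mathcal W)=\liminf_{M\to\infty}\liminf_{n\to\infty}-\frac1n\log\epsilon^{\rm NS}(M,\mathcal W^{\times n})$. Sphere-packing exponent: for $r>0$, $E_{\rm sp}(r,\mathcal W)=\sup_{\alpha\in(0,1]}\max_{P_X}\min_{Q_Y}\frac{1-\alpha}{\alpha}\big(D_\alpha(P_{XY}\|P_X\times Q_Y)-r\big)$ (the term for $\alpha=1$ being $0$), and $E_{\rm sp}(0^+,\mathcal W)=\lim_{r\to0^+}E_{\rm sp}(r,\mathcal W)$. *)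

(* Defs.v *)
From HB Require Import structures.
From mathcomp Require Import all_boot all_order all_algebra.
From mathcomp Require Import all_classical all_reals all_analysis.
Set Implicit Arguments. Unset Strict Implicit. Unset Printing Implicit Defensive.
Import Order.TTheory GRing.Theory Num.Theory Num.Def.
Import numFieldNormedType.Exports.
Local Open Scope classical_set_scope.
Local Open Scope ring_scope.

Section Defs.
Variable R : realType.

Definition is_dist (T : finType) (P : T -> R) : Prop :=
  (forall x, 0 <= P x) /\ \sum_x P x = 1.

Definition is_channel (X Y : finType) (W : X -> Y -> R) : Prop :=
  (forall x y, 0 <= W x y) /\ (forall x, \sum_y W x y = 1).

Definition KL (T : finType) (P Q : T -> R) : \bar R :=
  if [exists x, (0 < P x) && (Q x == 0)] then +oo%E
  else (\sum_(x | 0 < P x) P x * ln (P x / Q x))%:E.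

(* Renyi divergence D_alpha(P||Q), alpha in (0,1) u (1,oo) *)
Definition renyi (T : finType) (alpha : R) (P Q : T -> R) : \bar R :=
  let s := \sum_(x | 0 < P x) P x `^ alpha * Q x `^ (1 - alpha) in
  if (1 < alpha) && [exists x, (0 < P x) && (Q x == 0)] then +oo%E
  else if s == 0 then +oo%E (* only possible for alpha < 1: log 0 / (alpha-1) *)
  else (ln s / (alpha - 1))%:E.

Definition prodd (X Y : finType) (P : X -> R) (Q : Y -> R) : X * Y -> R :=
  fun xy => P xy.1 * Q xy.2.
Definition joint (X Y : finType) (P : X -> R) (W : X -> Y -> R) : X * Y -> R :=
  fun xy => P xy.1 * W xy.1 xy.2.

Definition umlaut (X Y : finType) (W : X -> Y -> R) : \bar R :=
  ereal_sup [set ereal_inf [set KL (prodd P Q) (joint P W) | Q in @is_dist Y]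
            | P in @is_dist X].

Definition Esp (X Y : finType) (W : X -> Y -> R) (r : R) : \bar R :=
  ereal_sup [set (if alpha == 1 then 0%E else
     ereal_sup [set ereal_inf
        [set (((1 - alpha) / alpha)%:E * (renyi alpha (joint P W) (prodd P Q) - r%:E))%E
        | Q in @is_dist Y] | P in @is_dist X])
   | alpha in `]0, 1]%classic].

Definition chan_pow (X Y : finType) (W : X -> Y -> R) (n : nat)
  : {ffun 'I_n -> X} -> {ffun 'I_n -> Y} -> R :=
  fun xn yn => \prod_(i < n) W (xn i) (yn i).
Arguments chan_pow {X Y} W n.

(* non-signalling codes: Z x w' y w = Z(x, w' | y, w) *)
Definition is_NS_code (X Y : finType) (M : nat) (Z : X -> 'I_M -> Y -> 'I_M -> R)
  : Prop :=
  (forall x w' y w, 0 <= Z x w' y w) /\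
  (forall y w, \sum_x \sum_w' Z x w' y w = 1) /\
  (forall w' y w1 w2, \sum_x Z x w' y w1 = \sum_x Z x w' y w2) /\
  (forall x y1 y2 w, \sum_w' Z x w' y1 w = \sum_w' Z x w' y2 w).

Definition NS_error (X Y : finType) (W : X -> Y -> R) (M : nat)
  (Z : X -> 'I_M -> Y -> 'I_M -> R) : R :=
  1 - M%:R^-1 * \sum_(w < M) \sum_x \sum_y W x y * Z x w y w.

Definition eps_NS (X Y : finType) (W : X -> Y -> R) (M : nat) : R :=
  inf [set NS_error W Z | Z in @is_NS_code X Y M].

Definition negloge (n : nat) (e : R) : \bar R :=
  if e == 0 then +oo%E else (- ln e / n%:R)%:E.

Definition ENS (X Y : finType) (W : X -> Y -> R) (r : R) : \bar R :=
  limn_einf (fun n => negloge n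
    (eps_NS (chan_pow W n) (absz (Num.ceil (expR (r * n%:R)))))).

Definition ENS0p (X Y : finType) (W : X -> Y -> R) : \bar R :=
  limf_einf (ENS W) (0^'+).

Definition ENS_0 (X Y : finType) (W : X -> Y -> R) : \bar R :=
  limn_einf (fun M => limn_einf (fun n => negloge n (eps_NS (chan_pow W n) M))).

End Defs.

(* Main.v *)
Require Import Defs.
From HB Require Import structures.
From mathcomp Require Import all_boot all_order all_algebra.
From mathcomp Require Import all_classical all_reals all_analysis.
From mathcomp Require Import ring lra zify.
Import Order.TTheory GRing.Theory Num.Theory Num.Def.
Import numFieldNormedType.Exports.
Local Open Scope classical_set_scope.
Local Open Scope ring_scope.

Set Implicit Arguments.
Unset Strict Implicit.
Unset Printing Implicit Defensive.

(** By Gibbs' inequality the umlaut information has the closed form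
    [U(W) = sup_P - ln g_0(P)], where
    [g_0(P) = sum_y prod_x W(y|x)^P(x)], and by Hoelder's inequality (Sibson's
    identity) the order-[a] sphere-packing term is [- ln g_a(P) - r (1 - a) / a], where
    [g_a(P) = sum_y (sum_x P(x) W(y|x)^a)^(1/a)].  Power means decrease to the geometric
    mean as [a] tends to [0], so both coincide in the limit [r -> 0].

    Symmetrizing over messages turns an NS code with [M] messages into an input
    distribution [P] and a test [0 <= A(x,y) <= P(x)] with [sum_x A(x,y) = 1 - 1/M] for
    every [y], whose error is [sum_(x,y) W(y|x) A(x,y)], and conversely.  Testing the
    likelihood of a product input against the threshold [M^(1/a) * (power mean)] gives an error at
    most [M^(1/a) g_a(P)^n].  In the other direction, the weighted AM-GM inequality
    for each [y] followed by Hoelder in [y] bounds the error below by a power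
    [M/(M-1)] of [g_0], up to factors that vanish in the exponent as [M] grows; and
    [g_0] of an arbitrary input to [n] uses of the channel is the product of the
    [g_0] of its marginals. *)

(** * Finite inequalities *)

Lemma powR_prod (R : realType) (I : finType) (f : I -> R) (r : R) :
  (forall i, 0 <= f i) -> (\prod_i f i) `^ r = \prod_i f i `^ r.
Proof.
move=> f0; suff [] : 0 <= \prod_i f i /\ (\prod_i f i) `^ r = \prod_i f i `^ r by [].
apply: (big_rec2 (fun a b => 0 <= a /\ a `^ r = b)); first by rewrite powR1.
move=> i a b _ [b0 <-]; split; first exact: mulr_ge0.
by rewrite powRM.
Qed.

(** Nonnegative exponents cover the base [x = 0] as well: since 0^0 = 1, both sides vanish as soon
    as one exponent is positive. *)
Lemma powR_sum (R : realType) (I : finType) (p : pred I) (e : I -> R) (x : R) :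
  (forall i, 0 <= e i) -> x `^ (\sum_(i | p i) e i) = \prod_(i | p i) x `^ e i.
Proof.
move=> e0.
suff [] : 0 <= \sum_(i | p i) e i /\
    x `^ (\sum_(i | p i) e i) = \prod_(i | p i) x `^ e i by [].
apply: (big_rec2 (fun a b => 0 <= a /\ x `^ a = b)); first by rewrite powRr0.
move=> i a b _ [a0 <-]; split; first exact: addr_ge0.
have [->|x0] := eqVneq x 0; last by rewrite powRD// x0 implybT.
have [ei|ei] := eqVneq (e i) 0; first by rewrite ei add0r powRr0 mul1r.
by rewrite (powR0 ei) mul0r powR0// paddr_eq0// negb_and ei.
Qed.

Lemma powR_expR_ln (R : realType) (z p : R) :
  0 <= z -> (p != 0 -> 0 < z) -> z `^ p = expR (p * ln z).
Proof.
move=> z0 pz; have [->|p0] := eqVneq p 0; first by rewrite powRr0 mul0r expR0.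
by rewrite /powR gt_eqF// pz.
Qed.

(** Concavity of [ln], with the tangent taken at [m]. Summed against weights for a suitable [m], the
    linear part drops out, which yields both AM-GM and Gibbs' inequality. *)
Lemma ln_le_tangent (R : realType) (z m : R) :
  0 < z -> 0 < m -> ln z <= ln m + (z / m - 1).
Proof.
move=> z0 m0; have zm : 0 < z / m by rewrite divr_gt0.
rewrite -lerBlDl -ln_div//.
have := @le_ln1Dx R (z / m - 1).
have -> : 1 + (z / m - 1) = z / m by ring.
by apply; lra.
Qed.

Lemma dist_support (R : realType) (T : finType) (p : T -> R) :
  is_dist p -> exists x, 0 < p x.
Proof.
move=> [p0 p1]; apply/not_existsP => pn.
suff : \sum_x p x = 0 by rewrite p1; move/eqP; rewrite oner_eq0.
rewrite big1// => x _; apply/eqP; rewrite eq_le p0 andbT leNgt; exact/negP.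
Qed.

Lemma weighted_amgm (R : realType) (T : finType) (p z : T -> R) :
  is_dist p -> (forall x, 0 <= z x) ->
  \prod_x z x `^ p x <= \sum_x p x * z x.
Proof.
move=> pd z0; have [p0 p1] := pd.
have pz0 x : 0 <= p x * z x by rewrite mulr_ge0.
(* A zero entry of nonzero weight kills the product; otherwise all entries of nonzero weight are
   positive and logarithms may be taken. *)
have [[x /andP[px /eqP zx]]|h] := pselect (exists x, (p x != 0) && (z x == 0)).
  by rewrite (bigD1 x)//= zx powR0// mul0r sumr_ge0.
have pz x : p x != 0 -> 0 < z x.
  move=> px; rewrite lt_neqAle z0 andbT eq_sym; apply/negP => zx.
  by apply: h; exists x; rewrite px.
have [x0 px0] := @dist_support _ _ _ pd.
set m := \sum_x p x * z x.
have m0 : 0 < m.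
  rewrite /m (bigD1 x0)//= ltr_wpDr ?sumr_ge0// mulr_gt0//.
  by rewrite pz// gt_eqF.
rewrite (eq_bigr (fun x => expR (p x * ln (z x)))); last first.
  by move=> x _; apply: powR_expR_ln => //; exact: pz.
rewrite -expR_sum -[leRHS](lnK m0) ler_expR.
(* The added terms sum to zero because [m] is the weighted mean; they prepare the tangent bound term
   by term. *)
have -> : ln m = \sum_x (p x * ln m + (p x * z x / m - p x)).
  rewrite big_split/= -mulr_suml p1 mul1r sumrB -mulr_suml -/m p1.
  by rewrite divff ?subrr ?addr0// gt_eqF.
apply: ler_sum => x _; have [->|px] := eqVneq (p x) 0.
  by rewrite !mul0r subrr addr0.
apply: (@le_trans _ _ (p x * (ln m + (z x / m - 1)))); last first.
  by rewrite le_eqVlt; apply/orP; left; apply/eqP; ring.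
by rewrite ler_wpM2l// ln_le_tangent// pz.
Qed.

Lemma young_powR (R : realType) (a x y : R) : 0 <= a <= 1 -> 0 <= x -> 0 <= y ->
  x `^ a * y `^ (1 - a) <= a * x + (1 - a) * y.
Proof.
move=> /andP[a0 a1] x0 y0.
have := @weighted_amgm R bool (fun b => if b then a else 1 - a)
  (fun b => if b then x else y).
rewrite !big_bool/=; apply; last by case.
by split; [case => //=; rewrite subr_ge0|rewrite big_bool/= addrC subrK].
Qed.

(** Both sums are scaled to 1; Young's inequality then holds term by term and adds up to
    [a + (1 - a)]. A zero sum makes every term vanish. *)
Lemma hoelder_sum (R : realType) (T : finType) (a : R) (f g : T -> R) :
  0 < a < 1 -> (forall x, 0 <= f x) -> (forall x, 0 <= g x) ->
  \sum_x f x `^ a * g x `^ (1 - a) <=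
  (\sum_x f x) `^ a * (\sum_x g x) `^ (1 - a).
Proof.
move=> /andP[a0 a1] f0 g0.
have a'0 : 1 - a != 0 by rewrite subr_eq0 eq_sym lt_eqF.
have key (h : T -> R) : (forall x, 0 <= h x) -> \sum_x h x != 0 -> 0 < \sum_x h x.
  by move=> h0 hn; rewrite lt_neqAle eq_sym hn sumr_ge0.
have zero (h : T -> R) : (forall x, 0 <= h x) -> \sum_x h x = 0 -> forall x, h x = 0.
  by move=> h0 /eqP; rewrite psumr_eq0// => /allP hs x; apply/eqP/(hs x)/mem_index_enum.
have [F0|F0] := eqVneq (\sum_x f x) 0.
  rewrite big1 ?mulr_ge0 ?powR_ge0// => x _.
  by rewrite (zero f)// powR0 ?mul0r// gt_eqF.
have [G0|G0] := eqVneq (\sum_x g x) 0.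
  rewrite big1 ?mulr_ge0 ?powR_ge0// => x _.
  by rewrite (zero g)// (powR0 a'0) mulr0.
set F := \sum_x f x in F0 *; set G := \sum_x g x in G0 *.
have Fp : 0 < F by exact: key.
have Gp : 0 < G by exact: key.
have -> : \sum_x f x `^ a * g x `^ (1 - a) =
  F `^ a * G `^ (1 - a) * \sum_x (f x / F) `^ a * (g x / G) `^ (1 - a).
  rewrite mulr_sumr; apply: eq_bigr => x _.
  rewrite mulrACA -!powRM ?divr_ge0 ?(ltW Fp) ?(ltW Gp)//.
  by rewrite !(mulrC _ (_ / _)) !divfK.
apply: ler_piMr; first by rewrite mulr_ge0 ?powR_ge0.
apply: (@le_trans _ _ (\sum_x (a * (f x / F) + (1 - a) * (g x / G)))).
  apply: ler_sum => x _; apply: young_powR; first by rewrite !ltW.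
    by rewrite divr_ge0// ltW.
  by rewrite divr_ge0// ltW.
rewrite big_split/= -!mulr_sumr -!mulr_suml -/F -/G !divff//.
by rewrite !mulr1 addrC subrK.
Qed.

(** * Extended real limits *)

Lemma limf_einf_ge (R : realType) (T : choiceType) (X : filteredType T)
    (f : X -> \bar R) (F : set (set X)) (c : \bar R) :
  F [set x | (c <= f x)%E] -> (c <= limf_einf f F)%E.
Proof.
move=> Fc; rewrite limf_einfE; apply: ereal_sup_ge.
exists (ereal_inf (f @` [set x | (c <= f x)%E])); first by exists [set x | (c <= f x)%E].
by apply: le_ereal_inf_tmp => _ [x /= cx <-].
Qed.

Lemma limf_einf_le (R : realType) (T : choiceType) (X : filteredType T)
    (f : X -> \bar R) (F : set (set X)) (FF : ProperFilter F) (c : R) :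
  (forall e : R, 0 < e -> F [set x | (f x <= (c + e)%:E)%E]) ->
  (limf_einf f F <= c%:E)%E.
Proof.
move=> Fc; rewrite limf_einfE; apply: ge_ereal_sup => _ [V FV <-].
apply/lee_addgt0Pr => e e0.
have [x [Vx fx]] := @filter_ex _ _ FF _ (filterI FV (Fc e e0)).
by apply: le_trans fx; apply: ereal_inf_lbound; exists x.
Qed.

(** Serves to bound a possibly infinite [umlaut W] from above by treating only real thresholds
    strictly below it. *)
Lemma lee_lt_fin (R : realType) (a b : \bar R) :
  (forall c : R, (c%:E < a)%E -> (c%:E <= b)%E) -> (a <= b)%E.
Proof.
case: a => [a| |] h; last by rewrite leNye.
  apply/lee_subgt0Pr => e e0; apply: h.
  by rewrite lte_fin ltrBlDr ltrDl.
have -> : b = +oo%E by apply/eqyP => c c0; exact/h/ltry.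
exact: lexx.
Qed.


Lemma cvge_from_below (R : realType) (T : Type) (F : set_system T)
    (FF : ProperFilter F) (f : T -> \bar R) (l : \bar R) :
  F [set x | (f x <= l)%E] ->
  (forall c : R, (c%:E < l)%E -> F [set x | (c%:E <= f x)%E]) ->
  f x @[x --> F] --> l.
Proof.
case: l => [l| |] ub lb.
- have fin : \forall x \near F, f x \is a fin_num.
    have lb1 : ((l - 1)%:E < l%:E)%E by rewrite lte_fin; lra.
    have := lb _ lb1; apply: filterS2 ub => x /= ux lx.
    by rewrite fin_numElt (lt_le_trans _ lx) ?ltNyr// (le_lt_trans ux) ?ltry.
  apply/fine_cvgP; split=> //; apply/cvgrPdist_le => e e0.
  have lbe : ((l - e)%:E < l%:E)%E by rewrite lte_fin; lra.
  have := lb _ lbe; apply: filterS3 ub fin => x /= ux fx lx.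
  move: ux lx; rewrite -{1 2}(fineK fx) !lee_fin => ux lx.
  by rewrite ler_norml; apply/andP; split; lra.
- apply/cvgeyPge => A; exact/lb/ltry.
- apply/cvgeNyPle => A; apply: filterS ub => x /= /le_trans; apply; exact: leNye.
Qed.

(** * Geometric and power means of a channel *)

(** Since 0^0 = 1, inputs of zero weight drop out: a zero of [W x y] matters only on the support of
    [P]. *)
Definition geom_mean {R : realType} {X Y : finType} (P : X -> R) (W : X -> Y -> R)
  (y : Y) : R := \prod_x W x y `^ P x.

Definition geom_affinity {R : realType} {X Y : finType} (P : X -> R)
  (W : X -> Y -> R) : R := \sum_y geom_mean P W y.

Definition power_mean {R : realType} {X Y : finType} (a : R) (P : X -> R)
  (W : X -> Y -> R) (y : Y) : R := (\sum_x P x * W x y `^ a) `^ a^-1.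

(** Its negative logarithm is Gallager's function E_0(rho, P) at rho = (1 - a) / a. *)
Definition power_affinity {R : realType} {X Y : finType} (a : R) (P : X -> R)
  (W : X -> Y -> R) : R := \sum_y power_mean a P W y.

Lemma geom_mean_ge0 (R : realType) (X Y : finType) (P : X -> R) (W : X -> Y -> R) y :
  0 <= geom_mean P W y.
Proof. by rewrite prodr_ge0// => x _; exact: powR_ge0. Qed.

Lemma power_mean_ge0 (R : realType) (X Y : finType) (a : R) (P : X -> R)
  (W : X -> Y -> R) y : 0 <= power_mean a P W y.
Proof. exact: powR_ge0. Qed.

Lemma channel_le1 (R : realType) (X Y : finType) (W : X -> Y -> R) x y :
  is_channel W -> W x y <= 1.
Proof.
by move=> [W0 W1]; rewrite -(W1 x) (bigD1 y)//= lerDl sumr_ge0.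
Qed.

Lemma power_sum_ge0 (R : realType) (X Y : finType) (a : R) (P : X -> R)
    (W : X -> Y -> R) y :
  is_dist P -> 0 <= \sum_x P x * W x y `^ a.
Proof. by move=> [P0 _]; rewrite sumr_ge0// => x _; rewrite mulr_ge0// powR_ge0. Qed.

Lemma power_meanK (R : realType) (X Y : finType) (a : R) (P : X -> R)
    (W : X -> Y -> R) y :
  0 < a -> is_dist P -> power_mean a P W y `^ a = \sum_x P x * W x y `^ a.
Proof.
by move=> a0 Pd; rewrite -powRrM mulVf ?gt_eqF// powRr1// power_sum_ge0.
Qed.

(** AM-GM for the numbers [W x y] raised to the power [a], followed by the increasing power 1/a. *)
Lemma geom_mean_le_power_mean (R : realType) (X Y : finType) (a : R) (P : X -> R)
    (W : X -> Y -> R) y :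
  0 < a -> is_dist P -> is_channel W -> geom_mean P W y <= power_mean a P W y.
Proof.
move=> a0 Pd [W0 _].
have -> : geom_mean P W y = (\prod_x (W x y `^ a) `^ P x) `^ a^-1.
  rewrite powR_prod => [|x]; last exact: powR_ge0.
  by apply: eq_bigr => x _; rewrite -!powRrM mulrCA divff ?mulr1// gt_eqF.
apply: ge0_ler_powR; rewrite ?nnegrE.
- by rewrite invr_ge0 ltW.
- by rewrite prodr_ge0// => x _; exact: powR_ge0.
- exact: power_sum_ge0.
- by apply: (@weighted_amgm _ _ P (fun x => W x y `^ a)) => // x; exact: powR_ge0.
Qed.

Lemma geom_affinity_le_power_affinity (R : realType) (X Y : finType) (a : R)
    (P : X -> R) (W : X -> Y -> R) :
  0 < a -> is_dist P -> is_channel W -> geom_affinity P W <= power_affinity a P W.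
Proof. by move=> *; apply: ler_sum => y _; exact: geom_mean_le_power_mean. Qed.

(** An input in the support reaches some output with positive probability. So [ln] is meaningful
    here, whereas [geom_affinity] may vanish. *)
Lemma power_affinity_gt0 (R : realType) (X Y : finType) (a : R)
    (P : X -> R) (W : X -> Y -> R) :
  is_dist P -> is_channel W -> 0 < power_affinity a P W.
Proof.
move=> Pd [W0 W1]; have [x px] := dist_support Pd; have [P0 _] := Pd.
have [y wy] : exists y, 0 < W x y by apply: (@dist_support R Y (W x)).
rewrite /power_affinity (bigD1 y)//= ltr_wpDr ?sumr_ge0 ?powR_gt0//.
  by move=> ? _; exact: powR_ge0.
rewrite (bigD1 x)//= ltr_wpDr ?mulr_gt0 ?powR_gt0//.
by apply: sumr_ge0 => z _; rewrite mulr_ge0// powR_ge0.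
Qed.

(** The limit is minus the derivative of w^s at s = 0. The bound 1 + t <= exp t, at t = s ln w and
    at t = - s ln w, gives the two sides of the squeeze. *)
Lemma cvg_difference_quotient (R : realType) (w : R) : 0 < w -> w <= 1 ->
  (1 - w `^ s) / s @[s --> 0^'+] --> - ln w.
Proof.
move=> w0 w1; have l0 : ln w <= 0 by exact: ln_le0.
apply: (@squeeze_cvgr _ _ _ _ (fun s => - ln w * (1 - s * ln w)^-1) (fun=> - ln w)).
- near=> s; have s0 : 0 < s by near: s; exact: nbhs_right_gt.
  have sl : s * ln w <= 0 by rewrite pmulr_rle0.
  have d0 : 0 < 1 - s * ln w by lra.
  have -> : w `^ s = expR (s * ln w) by rewrite /powR gt_eqF.
  apply/andP; split.
    rewrite ler_pdivlMr// mulrAC ler_pdivrMr//.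
    have e0 := expR_gt0 (s * ln w).
    have : expR (s * ln w) * (1 - s * ln w) <= 1.
      rewrite -ler_pdivlMl// mulr1 -expRN.
      by have := expR_ge1Dx (- (s * ln w)).
    lra.
  rewrite ler_pdivrMr//.
  have := expR_ge1Dx (s * ln w); lra.
- rewrite -[X in _ --> X]mulr1; apply: cvgMr; rewrite -[X in _ --> X]invr1.
  apply: cvgV; first exact: oner_neq0.
  rewrite -[X in _ --> X]subr0; apply: cvgB; first exact: cvg_cst.
  rewrite -[X in _ --> X](mul0r (ln w)); apply: cvgMl.
  exact: (@cvg_at_right_filter _ _ id).
- exact: cvg_cst.
Unshelve. all: by end_near. Qed.

(* The limit is [0] when [w = 0 < p] and [1] when [p = 0], matching [0 `^ 0 = 1]. *)
Lemma cvg_expR_difference_quotient (R : realType) (p w : R) :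
  0 <= p -> 0 <= w <= 1 ->
  expR (- (p * ((1 - w `^ s) / s))) @[s --> 0^'+] --> w `^ p.
Proof.
move=> p0 /andP[w0 w1]; have [->|pn0] := eqVneq p 0.
  rewrite powRr0; under eq_fun do rewrite mul0r oppr0 expR0; exact: cvg_cst.
have pp : 0 < p by rewrite lt_neqAle eq_sym pn0.
have [->|wn0] := eqVneq w 0.
  (* For [w = 0] the quotient is 1/s, and exp (p/s) >= p/s gives the upper function s/p. *)
  rewrite powR0//; apply: (@squeeze_cvgr _ _ _ _ (fun=> 0) (fun s => s / p)).
  - near=> s; have s0 : 0 < s by near: s; exact: nbhs_right_gt.
    rewrite expR_ge0/= powR0 ?gt_eqF// subr0 mul1r expRN.
    rewrite -[leRHS]invrK lef_pV2 ?posrE ?expR_gt0 ?invr_gt0 ?divr_gt0//.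
    rewrite invf_div; apply: le_trans (expR_ge1Dx _); lra.
  - exact: cvg_cst.
  - rewrite -[X in _ --> X](mul0r p^-1); apply: cvgMl.
    exact: (@cvg_at_right_filter _ _ id).
have wp : 0 < w by rewrite lt_neqAle eq_sym wn0.
have -> : w `^ p = expR (- (p * - ln w)) by rewrite /powR gt_eqF// mulrN opprK.
apply: (@continuous_cvg _ _ _ _ _ (fun s => - (p * ((1 - w `^ s) / s))) expR).
  exact: continuous_expR.
apply: cvgN; apply: cvgMr; exact: cvg_difference_quotient.
Unshelve. all: by end_near. Qed.

(** Apply 1 + t <= exp t to the power sum minus 1, then raise to the power 1/s. The product form
    lets the limit in [s] be taken factor by factor. *)
Lemma power_mean_le_expR (R : realType) (X Y : finType) (s : R) (P : X -> R)
    (W : X -> Y -> R) y : 0 < s -> is_dist P ->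
  power_mean s P W y <= \prod_x expR (- (P x * ((1 - W x y `^ s) / s))).
Proof.
move=> s0 Pd; have [P0 P1] := Pd.
rewrite -expR_sum.
have -> : \sum_x - (P x * ((1 - W x y `^ s) / s)) =
    (\sum_x P x * W x y `^ s - 1) * s^-1.
  rewrite -[X in (_ - X) * _]P1 -sumrB mulr_suml; apply: eq_bigr => x _; ring.
rewrite expRM; apply: ge0_ler_powR; rewrite ?nnegrE ?expR_ge0//.
- by rewrite invr_ge0 ltW.
- exact: power_sum_ge0.
- by apply: le_trans (expR_ge1Dx _); lra.
Qed.

Lemma power_affinity_approx (R : realType) (X Y : finType) (P : X -> R)
    (W : X -> Y -> R) (e : R) : is_dist P -> is_channel W -> 0 < e ->
  exists2 s : R, 0 < s < 1 & power_affinity s P W <= geom_affinity P W + e.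
Proof.
move=> Pd Wc e0; have [P0 _] := Pd; have [W0 _] := Wc.
have cv : \sum_y \prod_x expR (- (P x * ((1 - W x y `^ s) / s))) @[s --> 0^'+] -->
    geom_affinity P W.
  apply: (@cvg_big _ _ _ _ _ add_continuous) => y _.
  apply: (@cvg_big _ _ _ _ _ mul_continuous) => x _.
  by apply: cvg_expR_difference_quotient => //; rewrite W0 channel_le1.
have near_s : \forall s \near 0^'+,
    0 < s < 1 /\ power_affinity s P W <= geom_affinity P W + e.
  near=> s; have s0 : 0 < s by near: s; exact: nbhs_right_gt.
  split; first by rewrite s0/=; near: s; exact: nbhs_right_lt.
  apply: (@le_trans _ _ (\sum_y \prod_x expR (- (P x * ((1 - W x y `^ s) / s))))).
    by apply: ler_sum => y _; exact: power_mean_le_expR.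
  rewrite -lerBlDl; apply: le_trans (ler_norm _) _; rewrite distrC.
  by near: s; exact: ((cvgrPdist_le _ _).1 cv).
by have [s [s01 sl]] := filter_ex near_s; exists s.
Unshelve. all: by end_near. Qed.

(** * Umlaut information and sphere-packing exponent *)

(** The real [ln] is 0 at 0, so the value [+oo] there is set by hand. *)
Definition neglog {R : realType} (t : R) : \bar R :=
  if t == 0 then +oo%E else (- ln t)%:E.

Lemma dist_gt0 (R : realType) (T : finType) (P : T -> R) x :
  is_dist P -> P x != 0 -> 0 < P x.
Proof. by move=> [P0 _] Px; rewrite lt_neqAle eq_sym Px P0. Qed.

Lemma geom_mean_expR (R : realType) (X Y : finType) (P : X -> R) (W : X -> Y -> R) y :
  is_dist P -> is_channel W -> (forall x, 0 < P x -> 0 < W x y) ->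
  geom_mean P W y = expR (\sum_x P x * ln (W x y)).
Proof.
move=> Pd [W0 _] PW; rewrite expR_sum; apply: eq_bigr => x _.
by apply: powR_expR_ln => // /(dist_gt0 Pd); exact: PW.
Qed.

(** [P x] cancels in the likelihood ratio, and averaging [ln (W x y)] over [P] gives the logarithm
    of the geometric mean. The positivity hypothesis is absolute continuity. *)
Lemma KL_prodd_joint (R : realType) (X Y : finType) (P : X -> R) (Q : Y -> R)
    (W : X -> Y -> R) :
  is_dist P -> is_dist Q -> is_channel W ->
  (forall x y, 0 < P x -> 0 < Q y -> 0 < W x y) ->
  KL (prodd P Q) (joint P W) =
  (\sum_y Q y * (ln (Q y) - ln (geom_mean P W y)))%:E.
Proof.
move=> Pd Qd Wc PQW; have [P0 P1] := Pd; have [Q0 Q1] := Qd.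
rewrite /KL ifF; last first.
  apply/negbTE/existsPn => -[x y]; rewrite /prodd /joint/=.
  apply/negP => /andP[PQ /eqP PW].
  have Px : 0 < P x by apply: dist_gt0 => //; apply: contraTneq PQ => ->; rewrite mul0r ltxx.
  have Qy : 0 < Q y by apply: dist_gt0 => //; apply: contraTneq PQ => ->; rewrite mulr0 ltxx.
  by move/eqP: PW; rewrite mulf_eq0 !gt_eqF// PQW.
congr EFin; rewrite big_mkcond/=.
transitivity (\sum_y \sum_x Q y * (P x * ln (Q y) - P x * ln (W x y))).
  rewrite exchange_big/= pair_bigA/=; apply: eq_bigr => -[x y] _; rewrite /prodd /joint/=.
  have [Px|Px] := eqVneq (P x) 0; first by rewrite Px !mul0r ltxx subrr mulr0.
  have [Qy|Qy] := eqVneq (Q y) 0; first by rewrite Qy mulr0 ltxx mul0r.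
  have Pp := dist_gt0 Pd Px; have Qp := dist_gt0 Qd Qy.
  rewrite mulr_gt0// invfM mulrACA divff// mul1r.
  by rewrite ln_div ?posrE ?PQW//; ring.
apply: eq_bigr => y _; rewrite -mulr_sumr sumrB -mulr_suml P1 mul1r.
have [->|Qy] := eqVneq (Q y) 0; first by rewrite !mul0r.
rewrite geom_mean_expR ?expRK// => x Px; apply: PQW => //; exact: dist_gt0.
Qed.

(** Gibbs' inequality against the normalized geometric mean; without absolute continuity the
    divergence is already [+oo]. *)
Lemma KL_ge_neglog (R : realType) (X Y : finType) (P : X -> R) (Q : Y -> R)
    (W : X -> Y -> R) :
  is_dist P -> is_dist Q -> is_channel W ->
  (neglog (geom_affinity P W) <= KL (prodd P Q) (joint P W))%E.
Proof.
move=> Pd Qd Wc; have [P0 P1] := Pd; have [Q0 Q1] := Qd; have [W0 _] := Wc.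
have [bad|good] := boolP [exists xy, (0 < prodd P Q xy) && (joint P W xy == 0)].
  by rewrite /KL bad leey.
have PQW x y : 0 < P x -> 0 < Q y -> 0 < W x y.
  move=> Px Qy; rewrite lt_neqAle W0 andbT eq_sym.
  move/existsPn/(_ (x, y)): good; rewrite /prodd /joint/= mulr_gt0//=.
  by apply: contra => /eqP ->; rewrite mulr0.
have gp y : 0 < Q y -> 0 < geom_mean P W y.
  by move=> Qy; rewrite geom_mean_expR ?expR_gt0// => x Px; exact: PQW.
rewrite KL_prodd_joint//.
have [y0 Qy0] := dist_support Qd.
have Gp : 0 < geom_affinity P W.
  rewrite /geom_affinity (bigD1 y0)//= ltr_wpDr ?gp// sumr_ge0// => y _.
  exact: geom_mean_ge0.
rewrite /neglog gt_eqF// lee_fin -lerN2 opprK -sumrN.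
set G := geom_affinity P W in Gp *.
(* Tangent bound at [G]. Where [Q y = 0] the summand is the nonnegative [geom_mean P W y / G], so
   the sum runs over all outputs and its bracketed part cancels. *)
apply: (@le_trans _ _ (\sum_y (Q y * ln G + (geom_mean P W y / G - Q y)))).
  apply: ler_sum => y _; have [->|Qy] := eqVneq (Q y) 0.
    by rewrite !mul0r subr0 add0r oppr0 divr_ge0 ?geom_mean_ge0// ltW.
  have Qp := dist_gt0 Qd Qy; have gy := gp _ Qp.
  have -> : geom_mean P W y / G - Q y = Q y * (geom_mean P W y / (G * Q y) - 1).
    by field; rewrite Qy gt_eqF.
  rewrite -mulrDr -mulrN ler_wpM2l// opprB.
  have -> : ln (geom_mean P W y) - ln (Q y) = ln (geom_mean P W y / Q y).
    by rewrite ln_div.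
  by rewrite invfM (mulrC G^-1) mulrA ln_le_tangent// divr_gt0.
rewrite big_split/= -mulr_suml Q1 mul1r sumrB -mulr_suml Q1 -/(geom_affinity P W).
by rewrite divff ?gt_eqF// subrr addr0.
Qed.

(** The normalized geometric mean is the equality case of Gibbs' inequality. If the affinity is
    zero, the lower bound is already [+oo]. *)
Lemma ereal_inf_KL (R : realType) (X Y : finType) (P : X -> R) (W : X -> Y -> R) :
  is_dist P -> is_channel W ->
  ereal_inf [set KL (prodd P Q) (joint P W) | Q in @is_dist R Y] =
  neglog (geom_affinity P W).
Proof.
move=> Pd Wc; have [P0 P1] := Pd; have [W0 _] := Wc.
apply/eqP; rewrite eq_le; apply/andP; split; last first.
  by apply: le_ereal_inf_tmp => _ [Q Qd <-]; exact: KL_ge_neglog.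
rewrite /neglog; case: ifPn => [_|Gn]; first exact: leey.
set G := geom_affinity P W in Gn *.
have Gp : 0 < G by rewrite lt_neqAle eq_sym Gn sumr_ge0// => y _; exact: geom_mean_ge0.
pose Q y := geom_mean P W y / G.
have Qd : is_dist Q.
  split => [y|]; first by rewrite divr_ge0 ?geom_mean_ge0// ltW.
  by rewrite -mulr_suml divff.
apply: ereal_inf_lbound; exists Q => //.
rewrite KL_prodd_joint//; last first.
  move=> x y Px; rewrite pmulr_lgt0 ?invr_gt0// => gy.
  rewrite lt_neqAle W0 andbT eq_sym; apply: contraTneq gy => Wz.
  by rewrite /geom_mean (bigD1 x)//= Wz powR0 ?gt_eqF// mul0r ltxx.
congr EFin; rewrite (eq_bigr (fun y => Q y * (- ln G))).
  by rewrite -mulr_suml; case: Qd => _ ->; rewrite mul1r.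
move=> y _; have [->|Qy] := eqVneq (Q y) 0; first by rewrite !mul0r.
have gy : 0 < geom_mean P W y.
  have := dist_gt0 Qd Qy; by rewrite pmulr_lgt0 ?invr_gt0.
by congr (_ * _); rewrite /Q ln_div//; ring.
Qed.

Lemma umlaut_geom_affinity (R : realType) (X Y : finType) (W : X -> Y -> R) :
  is_channel W ->
  umlaut W = ereal_sup [set neglog (geom_affinity P W) | P in @is_dist R X].
Proof.
move=> Wc; congr ereal_sup; apply/seteqP; split => _ [P Pd <-]; exists P => //.
  by rewrite ereal_inf_KL.
by rewrite ereal_inf_KL.
Qed.

Lemma neglog_le_umlaut (R : realType) (X Y : finType) (P : X -> R) (W : X -> Y -> R) :
  is_dist P -> is_channel W -> (neglog (geom_affinity P W) <= umlaut W)%E.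
Proof.
by move=> Pd Wc; rewrite umlaut_geom_affinity//; apply: ereal_sup_ubound; exists P.
Qed.

Lemma geom_affinity_ge0 (R : realType) (X Y : finType) (P : X -> R) (W : X -> Y -> R) :
  0 <= geom_affinity P W.
Proof. by rewrite sumr_ge0// => y _; exact: geom_mean_ge0. Qed.

(** At order one the power affinity is a total output mass, hence 1, and it dominates the geometric
    affinity. *)
Lemma umlaut_ge0 (R : realType) (X Y : finType) (W : X -> Y -> R) :
  (0 < #|X|)%N -> is_channel W -> (0 <= umlaut W)%E.
Proof.
move=> /card_gt0P[x0 _] Wc; have [W0 W1] := Wc.
pose P x : R := (x == x0)%:R.
have Pd : is_dist P.
  split => [x|]; first exact: ler0n.
  by rewrite (bigD1 x0)//= big1 /P ?eqxx ?addr0// => x /negbTE ->.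
apply: le_trans (neglog_le_umlaut Pd Wc).
have := geom_affinity_le_power_affinity (@ltr01 R) Pd Wc.
have -> : power_affinity 1 P W = 1.
  rewrite -[RHS](W1 x0) /power_affinity; apply: eq_bigr => y _.
  rewrite /power_mean invr1 (bigD1 x0)//= /P eqxx mul1r big1 => [|x /negbTE ->].
    by rewrite addr0 !powRr1// powR_ge0.
  by rewrite mul0r.
move=> G1; rewrite /neglog; case: ifPn => [_|Gn]; first exact: leey.
by rewrite lee_fin oppr_ge0 ln_le0.
Qed.

(** The strict gap below the supremum pays for replacing a geometric affinity by a power affinity.
    Every lower bound on an exponent starts from this choice of order and input. *)
Lemma lt_umlaut_power_affinity (R : realType) (X Y : finType) (W : X -> Y -> R)
    (c : R) : is_channel W -> (c%:E < umlaut W)%E ->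
  exists2 s : R, 0 < s < 1 &
    exists2 P : X -> R, is_dist P & c < - ln (power_affinity s P W).
Proof.
move=> Wc; rewrite umlaut_geom_affinity// => /ereal_sup_gt[_ [P Pd <-]] cP.
have Gc : geom_affinity P W < expR (- c).
  move: cP; rewrite /neglog; case: eqVneq => [-> _|Gn]; first exact: expR_gt0.
  have Gp : 0 < geom_affinity P W by rewrite lt_neqAle eq_sym Gn geom_affinity_ge0.
  by rewrite lte_fin ltrNr => cG; rewrite -[ltLHS](lnK Gp) ltr_expR.
have e0 : 0 < (expR (- c) - geom_affinity P W) / 2 by rewrite divr_gt0// subr_gt0.
have [s s01 sG] := power_affinity_approx Pd Wc e0; exists s => //; exists P => //.
have gp := power_affinity_gt0 s Pd Wc.
rewrite ltrNr -ltr_expR (lnK gp); apply: le_lt_trans sG _; lra.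
Qed.

(** The powers [a] and [1 - a] of [P x] recombine to [P x], so summing over [x] leaves a power of
    the power mean. *)
Lemma renyi_joint_prodd (R : realType) (X Y : finType) (a : R) (P : X -> R)
    (Q : Y -> R) (W : X -> Y -> R) :
  0 < a < 1 -> is_dist P -> is_dist Q -> is_channel W ->
  let S := \sum_y power_mean a P W y `^ a * Q y `^ (1 - a) in
  renyi a (joint P W) (prodd P Q) =
  if S == 0 then +oo%E else (ln S / (a - 1))%:E.
Proof.
move=> /andP[a0 a1] Pd Qd Wc S; have [P0 P1] := Pd; have [Q0 Q1] := Qd.
have [W0 _] := Wc.
rewrite /renyi ltNge (ltW a1)/=.
suff -> : \sum_(x | 0 < joint P W x) joint P W x `^ a * prodd P Q x `^ (1 - a) = S by [].
rewrite big_mkcond/= /S.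
under [in RHS]eq_bigr do rewrite power_meanK// mulr_suml.
rewrite exchange_big/= pair_bigA/=; apply: eq_bigr => -[x y] _.
rewrite /joint /prodd/= !powRM//.
have [Px|Px] := eqVneq (P x) 0; first by rewrite Px !mul0r ltxx.
have [Wxy|Wxy] := eqVneq (W x y) 0.
  by rewrite Wxy mulr0 ltxx powR0 ?gt_eqF// !(mulr0, mul0r).
rewrite mulr_gt0 ?(dist_gt0 Pd)//; last by rewrite lt_neqAle eq_sym Wxy W0.
rewrite mulrACA -powRD; last by rewrite Px implybT.
by rewrite addrC subrK powRr1// mulrA.
Qed.

(** Hoelder's inequality bounds the Renyi sum by the [a]-th power of the power affinity, whatever
    [Q] is. *)
Lemma Esp_ge (R : realType) (X Y : finType) (a r : R) (P : X -> R)
    (W : X -> Y -> R) :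
  0 < a < 1 -> 0 <= r -> is_dist P -> is_channel W ->
  ((- ln (power_affinity a P W) - r / a)%:E <= Esp W r)%E.
Proof.
move=> a01 r0 Pd Wc; have [a0 a1] := andP a01.
apply: ereal_sup_ge; exists (ereal_sup [set ereal_inf
  [set (((1 - a) / a)%:E * (renyi a (joint P W) (prodd P Q) - r%:E))%E
  | Q in @is_dist R Y] | P in @is_dist R X]).
  exists a; last by rewrite lt_eqF.
  by rewrite /= in_itv/= a0 ltW.
apply: ereal_sup_ge; eexists; first by exists P.
apply: le_ereal_inf_tmp => _ [Q Qd <-]; rewrite renyi_joint_prodd//.
have c0 : 0 < (1 - a) / a by rewrite divr_gt0// subr_gt0.
set S := \sum_y _; case: ifPn => [_|Sn].
  by rewrite addye// gt0_muley ?lte_fin// leey.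
have Sp : 0 < S.
  rewrite lt_neqAle eq_sym Sn sumr_ge0// => y _; rewrite mulr_ge0// powR_ge0//.
rewrite -EFinB -EFinM lee_fin.
(* The exact rate term is - r/a + r; the nonnegative [r] is dropped. *)
have -> : (1 - a) / a * (ln S / (a - 1) - r) = - (ln S / a) - r / a + r.
  by field; rewrite gt_eqF//= subr_eq0 lt_eqF.
have gp := power_affinity_gt0 a Pd Wc.
suff : ln S / a <= ln (power_affinity a P W) by lra.
rewrite ler_pdivrMr// mulrC -ln_powR ler_ln ?posrE ?powR_gt0//.
have := hoelder_sum a01 (power_mean_ge0 a P W) (proj1 Qd).
by rewrite (proj2 Qd) powR1 mulr1.
Qed.

(** Taking [Q] proportional to the power mean is the equality case of Hoelder and turns the Renyi
    sum into [g] to the power [a]. The order-one term is 0, which calls for [umlaut_ge0]. *)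
Lemma Esp_le_umlaut (R : realType) (X Y : finType) (r : R) (W : X -> Y -> R) :
  (0 < #|X|)%N -> 0 <= r -> is_channel W -> (Esp W r <= umlaut W)%E.
Proof.
move=> X0 r0 Wc; apply: ge_ereal_sup => _ [a /= aI <-]; move: aI; rewrite in_itv/= => /andP[a0 a1].
case: ifPn => [_|an]; first exact: umlaut_ge0.
have a01 : 0 < a < 1 by rewrite a0 lt_neqAle an a1.
apply: ge_ereal_sup => _ [P Pd <-].
apply: le_trans (neglog_le_umlaut Pd Wc).
have gp := power_affinity_gt0 a Pd Wc.
set g := power_affinity a P W in gp.
pose Q y := power_mean a P W y / g.
have Qd : is_dist Q.
  split => [y|]; first by rewrite divr_ge0 ?power_mean_ge0// ltW.
  by rewrite -mulr_suml divff// gt_eqF.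
apply: le_trans; first by apply: ereal_inf_lbound; exists Q.
rewrite renyi_joint_prodd//.
have -> : \sum_y power_mean a P W y `^ a * Q y `^ (1 - a) = g `^ a.
  rewrite /Q (eq_bigr (fun y => power_mean a P W y * (g^-1 `^ (1 - a)))).
    rewrite -mulr_suml -/(power_affinity a P W) -/g.
    rewrite -powR_inv1 ?(ltW gp)// -powRrM -[X in X * _](@powRr1 _ g) ?(ltW gp)//.
    rewrite -powRD; last by rewrite (gt_eqF gp) implybT.
    by congr (_ `^ _); ring.
  move=> y _; have m0 := power_mean_ge0 a P W y.
  rewrite powRM// ?invr_ge0 ?(ltW gp)// mulrA -powRD; last first.
    by rewrite addrC subrK oner_eq0.
  by rewrite addrC subrK powRr1.
rewrite gt_eqF ?powR_gt0// ln_powR -EFinB -EFinM.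
have -> : (1 - a) / a * (a * ln g / (a - 1) - r) = - ln g - (1 - a) / a * r.
  by field; rewrite gt_eqF//= subr_eq0.
rewrite /neglog; case: ifPn => [_|Gn]; first exact: leey.
have Gp : 0 < geom_affinity P W by rewrite lt_neqAle eq_sym Gn geom_affinity_ge0.
rewrite lee_fin.
have := geom_affinity_le_power_affinity a0 Pd Wc.
rewrite -/g -ler_ln ?posrE// => Gg.
have : 0 <= (1 - a) / a * r by rewrite mulr_ge0// divr_ge0 ?subr_ge0// ltW.
lra.
Qed.

Lemma cvg_Esp_umlaut (R : realType) (X Y : finType) (W : X -> Y -> R) :
  (0 < #|X|)%N -> is_channel W -> Esp W r @[r --> 0^'+] --> umlaut W.
Proof.
move=> X0 Wc; apply: cvge_from_below => [|c cU].
  by near=> r; apply: Esp_le_umlaut.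
(* The order [s] is fixed before [r], so the penalty r/s vanishes in the limit. *)
have [s s01 [P Pd cg]] := lt_umlaut_power_affinity Wc cU.
near=> r; apply: le_trans (Esp_ge s01 _ Pd Wc) => //.
have [s0 _] := andP s01.
rewrite lee_fin lerBrDr -lerBrDl ler_pdivrMr// ltW//.
near: r; apply: nbhs_right_lt; rewrite mulr_gt0//; lra.
Unshelve. all: by end_near. Qed.

(** * Product channels and non-signalling codes *)

Definition dist_pow {R : realType} {X : finType} (P : X -> R) (n : nat)
  (xn : {ffun 'I_n -> X}) : R := \prod_i P (xn i).

Definition marginal {R : realType} {X : finType} {n : nat}
  (P : {ffun 'I_n -> X} -> R) (i : 'I_n) (x : X) : R := 
  \sum_(xn : {ffun 'I_n -> X} | xn i == x) P xn.

Lemma is_dist_pow (R : realType) (X : finType) (P : X -> R) (n : nat) :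
  is_dist P -> is_dist (@dist_pow _ _ P n).
Proof.
move=> [P0 P1]; split => [xn|]; first by rewrite prodr_ge0.
transitivity (\prod_(i < n) \sum_x P x); last by rewrite big1.
by rewrite bigA_distr_bigA.
Qed.

Lemma is_channel_pow (R : realType) (X Y : finType) (W : X -> Y -> R) (n : nat) :
  is_channel W -> is_channel (chan_pow W (n := n)).
Proof.
move=> [W0 W1]; split => [xn yn|xn]; first by rewrite prodr_ge0.
transitivity (\prod_(i < n) \sum_y W (xn i) y); last by rewrite big1.
by rewrite bigA_distr_bigA.
Qed.

Lemma is_dist_marginal (R : realType) (X : finType) (n : nat)
    (P : {ffun 'I_n -> X} -> R) (i : 'I_n) :
  is_dist P -> is_dist (marginal P i).
Proof.
move=> [P0 P1]; split => [x|]; first by rewrite sumr_ge0.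
by rewrite -P1 (partition_big (fun xn : {ffun 'I_n -> X} => xn i) xpredT).
Qed.

Lemma power_affinity_pow (R : realType) (X Y : finType) (a : R) (P : X -> R)
    (W : X -> Y -> R) (n : nat) :
  is_dist P -> is_channel W ->
  power_affinity a (@dist_pow _ _ P n) (chan_pow W (n := n)) =
  power_affinity a P W ^+ n.
Proof.
move=> Pd [W0 _].
have -> : power_affinity a P W ^+ n = \prod_(i < n) power_affinity a P W.
  by rewrite prodr_const card_ord.
rewrite (bigA_distr_bigA (fun _ : 'I_n => power_mean a P W)).
apply: eq_bigr => yn _.
rewrite -powR_prod => [|i]; last exact: power_sum_ge0.
congr (_ `^ _).
rewrite (bigA_distr_bigA (fun i x => P x * W x (yn i) `^ a)).
by apply: eq_bigr => xn _; rewrite big_split/= powR_prod.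
Qed.

(* [log geom_mean] is linear in the input distribution, so only the marginals matter. *)
Lemma geom_affinity_pow (R : realType) (X Y : finType) (W : X -> Y -> R) (n : nat)
    (P : {ffun 'I_n -> X} -> R) :
  is_dist P -> is_channel W ->
  geom_affinity P (chan_pow W (n := n)) = \prod_i geom_affinity (marginal P i) W.
Proof.
move=> [P0 _] [W0 _].
rewrite (bigA_distr_bigA (fun i => geom_mean (marginal P i) W)).
apply: eq_bigr => yn _; rewrite /geom_mean /chan_pow.
under eq_bigr do rewrite powR_prod//.
rewrite exchange_big/=; apply: eq_bigr => i _.
rewrite (partition_big (fun xn : {ffun 'I_n -> X} => xn i) xpredT)//=.
apply: eq_bigr => x _; rewrite /marginal powR_sum//.
by apply: eq_bigr => xn /eqP ->.
Qed.


(* [A x y] is the mass of the event "input [x], decoding error" given output [y]. *)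
Lemma NS_code_test (R : realType) (X Y : finType) (W : X -> Y -> R) (M : nat)
    (Z : X -> 'I_M.+1 -> Y -> 'I_M.+1 -> R) (y0 : Y) :
  is_channel W -> is_NS_code Z ->
  exists2 P : X -> R, is_dist P & exists2 A : X -> Y -> R,
    (forall x y, 0 <= A x y <= P x) /\ (forall y, \sum_x A x y = 1 - M.+1%:R^-1)
    & NS_error W Z = \sum_x \sum_y W x y * A x y.
Proof.
move=> [W0 W1] [Z0 [Z1 [Zx Zw]]].
have Mn : (M.+1%:R : R) != 0 by rewrite pnatr_eq0.
have M1 : 0 <= (M.+1%:R : R)^-1 by rewrite invr_ge0 ler0n.
have avg (f : 'I_M.+1 -> R) (c : R) : (forall w, f w = c) ->
    M.+1%:R^-1 * \sum_w f w = c.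
  move=> fc; rewrite (eq_bigr (fun=> c))// sumr_const card_ord.
  by rewrite -[c *+ _]mulr_natl mulKf.
pose S x y := M.+1%:R^-1 * \sum_w Z x w y w.
pose P x := M.+1%:R^-1 * \sum_w \sum_w' Z x w' y0 w.
(* The law of the channel input does not depend on the output, so evaluating it at [y0] loses
   nothing. *)
have PE x y : P x = M.+1%:R^-1 * \sum_w \sum_w' Z x w' y w.
  by congr (_ * _); apply: eq_bigr => w _; exact: Zw.
have P0 x : 0 <= P x by rewrite mulr_ge0// !sumr_ge0// => w _; rewrite sumr_ge0.
have P1 : \sum_x P x = 1.
  by rewrite -mulr_sumr exchange_big/=; apply: avg => w; exact: Z1.
(* The law of the guess does not depend on the message, so a uniform message is guessed with
   probability exactly one over the number of messages. *)
have S1 y : \sum_x S x y = M.+1%:R^-1.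
  rewrite -mulr_sumr exchange_big/= -[RHS]mulr1; congr (_ * _).
  rewrite -(Z1 y ord0) [in RHS]exchange_big/=; apply: eq_bigr => w _; exact: Zx.
exists P => //; exists (fun x y => P x - S x y); first split.
- move=> x y; rewrite subr_ge0 lerBlDr lerDl; apply/andP; split; last first.
    by rewrite mulr_ge0// sumr_ge0.
  rewrite (PE x y) ler_wpM2l// ler_sum// => w _.
  by rewrite [leRHS](bigD1 w)//= lerDl sumr_ge0.
- by move=> y; rewrite sumrB P1 S1.
rewrite /NS_error -[X in X - _]P1.
have -> : \sum_x P x = \sum_x \sum_y W x y * P x.
  by apply: eq_bigr => x _; rewrite -mulr_suml W1 mul1r.
rewrite [X in _ - _ * X]exchange_big/= mulr_sumr -sumrB; apply: eq_bigr => x _.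
rewrite [X in _ - _ * X]exchange_big/= mulr_sumr -sumrB; apply: eq_bigr => y _.
by rewrite mulrBr /S -mulr_sumr; congr (_ - _); rewrite mulrCA.
Qed.

(** The code puts mass [P x - A x y] on the true message and spreads [A x y] evenly over the [M.+1]
    wrong ones. The condition on the sums of [A] makes every guess equally likely, hence independent
    of the message. *)
Lemma NS_code_of_test (R : realType) (X Y : finType) (W : X -> Y -> R) (M : nat)
    (P : X -> R) (A : X -> Y -> R) :
  is_channel W -> is_dist P -> (forall x y, 0 <= A x y <= P x) ->
  (forall y, \sum_x A x y = 1 - M.+2%:R^-1) ->
  exists2 Z : X -> 'I_M.+2 -> Y -> 'I_M.+2 -> R, is_NS_code Z &
    NS_error W Z = \sum_x \sum_y W x y * A x y.
Proof.
move=> [W0 W1] [P0 P1] AP A1.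
have Mn : (M.+2%:R : R) != 0 by rewrite pnatr_eq0.
have M1n : (M.+1%:R : R) != 0 by rewrite pnatr_eq0.
have MS : (M.+2%:R : R) = M.+1%:R + 1 by rewrite -natr1.
pose Z x (w' : 'I_M.+2) y w := if w' == w then P x - A x y else A x y / M.+1%:R.
have Zsum x y w : \sum_w' Z x w' y w = P x.
  rewrite (bigD1 w)//= {1}/Z eqxx (eq_bigr (fun=> A x y / M.+1%:R)); last first.
    by move=> w' /negbTE ww'; rewrite /Z ww'.
  rewrite sumr_const cardC1 card_ord/= -[_ *+ _]mulr_natr divfK//.
  by rewrite subrK.
have Zx w' y w : \sum_x Z x w' y w = M.+2%:R^-1.
  rewrite /Z; case: (w' == w); first by rewrite sumrB P1 A1; ring.
  rewrite -mulr_suml A1 -[X in X - _](mulfV Mn) -[X in _ - X]mul1r -mulrBl MS addrK.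
  by rewrite mulrAC divff// mul1r.
exists Z; first split.
- move=> x w' y w; have /andP[A0 AP'] := AP x y.
  by rewrite /Z; case: ifP => _; rewrite ?subr_ge0// divr_ge0.
- split; first by move=> y w; under eq_bigr do rewrite Zsum.
  by split => [w' y w1 w2|x y1 y2 w]; rewrite ?Zx// !Zsum.
rewrite /NS_error (eq_bigr (fun=> \sum_x \sum_y W x y * (P x - A x y))); last first.
  move=> w _; apply: eq_bigr => x _; apply: eq_bigr => y _.
  by rewrite /Z eqxx.
rewrite sumr_const card_ord -[(\sum_x _) *+ _]mulr_natl mulKf// -[X in X - _]P1 -sumrB.
apply: eq_bigr => x _; have {1}<- : \sum_y W x y * P x = P x by rewrite -mulr_suml W1 mul1r.
rewrite -sumrB.
by apply: eq_bigr => y _; ring.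
Qed.

Lemma NS_error_ge0 (R : realType) (X Y : finType) (W : X -> Y -> R) (M : nat)
    (Z : X -> 'I_M.+1 -> Y -> 'I_M.+1 -> R) (y0 : Y) :
  is_channel W -> is_NS_code Z -> 0 <= NS_error W Z.
Proof.
move=> Wc Zc; have [P _ [A [AP _] ->]] := NS_code_test y0 Wc Zc.
apply: sumr_ge0 => x _; apply: sumr_ge0 => y _.
by rewrite mulr_ge0 ?(proj1 Wc)//; have /andP[] := AP x y.
Qed.

(** Scaling the test down at each output to the exact total mass yields a code and only lowers the
    error. *)
Lemma eps_NS_le (R : realType) (X Y : finType) (W : X -> Y -> R) (M : nat)
    (y0 : Y) (P : X -> R) (A : X -> Y -> R) :
  is_channel W -> is_dist P -> (forall x y, 0 <= A x y <= P x) ->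
  (forall y, 1 - M.+2%:R^-1 <= \sum_x A x y) ->
  eps_NS W M.+2 <= \sum_x \sum_y W x y * A x y.
Proof.
move=> Wc Pd AP A1; have [W0 W1] := Wc.
have m0 : 0 < 1 - (M.+2%:R : R)^-1.
  by rewrite subr_gt0 invf_lt1 ?ltr0n// ltr1n.
pose c y := (1 - M.+2%:R^-1) / \sum_x A x y.
have Ap y : 0 < \sum_x A x y by exact: lt_le_trans (A1 y).
have c01 y : 0 <= c y <= 1.
  by rewrite divr_ge0 ?(ltW m0) ?(ltW (Ap y))//= ler_pdivrMr// mul1r.
have [||Z Zc Ze] := @NS_code_of_test R X Y W M P (fun x y => A x y * c y) Wc Pd.
- move=> x y; have /andP[A0 AP'] := AP x y; have /andP[c0 c1] := c01 y.
  rewrite mulr_ge0//=; apply: le_trans AP'; exact: ler_piMr.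
- by move=> y; rewrite -mulr_suml mulrC divfK// gt_eqF.
apply: (@le_trans _ _ (NS_error W Z)).
  apply: ge_inf; last by exists Z.
  by exists 0 => _ [Z' Z'c <-]; exact: NS_error_ge0.
rewrite Ze; apply: ler_sum => x _; apply: ler_sum => y _.
rewrite ler_wpM2l//; apply: ler_piMr; first by case/andP: (AP x y).
by case/andP: (c01 y).
Qed.

(** The test that ignores the output corresponds to uniform guessing. An inhabitant is needed to
    bound the real [inf] from below. *)
Lemma NS_codes_nonempty (R : realType) (X Y : finType) (W : X -> Y -> R) (M : nat)
    (P : X -> R) :
  is_channel W -> is_dist P -> exists Z, @is_NS_code R X Y M.+2 Z.
Proof.
move=> Wc Pd; have [P0 P1] := Pd.
have M0 : (M.+2%:R^-1 : R) <= 1 by rewrite invf_le1 ?ltr0n// ler1n.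
have M1 : 0 <= (M.+2%:R^-1 : R) by rewrite invr_ge0 ler0n.
have [||Z Zc _] := @NS_code_of_test R X Y W M P (fun x _ => P x * (1 - M.+2%:R^-1)) Wc Pd.
- by move=> x _; rewrite mulr_ge0 ?subr_ge0//= ler_piMr// gerBl.
- by move=> y; rewrite -mulr_suml P1 mul1r.
by exists Z.
Qed.

Lemma eps_NS_ge (R : realType) (X Y : finType) (W : X -> Y -> R) (M : nat)
    (P : X -> R) (b : R) : is_channel W -> is_dist P ->
  (forall Z, @is_NS_code R X Y M.+2 Z -> b <= NS_error W Z) -> b <= eps_NS W M.+2.
Proof.
move=> Wc Pd bZ; apply: lb_le_inf; last by move=> _ [Z Zc <-]; exact: bZ.
by have [Z Zc] := NS_codes_nonempty M Wc Pd; exists (NS_error W Z), Z.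
Qed.

Lemma eps_NS_ge0 (R : realType) (X Y : finType) (W : X -> Y -> R) (M : nat)
    (P : X -> R) (y0 : Y) : is_channel W -> is_dist P -> 0 <= eps_NS W M.+2.
Proof.
by move=> Wc Pd; apply: (eps_NS_ge Wc Pd) => Z Zc; exact: NS_error_ge0.
Qed.

(* Errors are confined to the inputs whose likelihood is at most a threshold depending
   on [y]; Markov's inequality for [W x y `^ a] bounds the mass of the others by [1 / M]. *)
Lemma eps_NS_le_power_affinity (R : realType) (X Y : finType) (a : R) (P : X -> R)
    (W : X -> Y -> R) (M : nat) (y0 : Y) :
  0 < a -> is_dist P -> is_channel W ->
  eps_NS W M.+2 <= M.+2%:R `^ a^-1 * power_affinity a P W.
Proof.
move=> a0 Pd Wc; have [P0 P1] := Pd; have [W0 W1] := Wc.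
pose t y := M.+2%:R `^ a^-1 * power_mean a P W y.
have t0 y : 0 <= t y by rewrite mulr_ge0 ?powR_ge0.
have ta y : t y `^ a = M.+2%:R * \sum_x P x * W x y `^ a.
  rewrite powRM ?powR_ge0// power_meanK//; congr (_ * _).
  by rewrite -powRrM mulVf ?gt_eqF// powRr1.
pose A x y := if W x y <= t y then P x else 0.
have AP x y : 0 <= A x y <= P x by rewrite /A; case: ifP => _; rewrite ?lexx ?P0.
apply: (@le_trans _ _ (\sum_x \sum_y W x y * A x y)).
  apply: (eps_NS_le y0 Wc Pd AP) => y.
  rewrite lerBlDr -lerBlDl -[X in X - _]P1 -sumrB.
  (* If the power sum is zero, inputs of positive mass have likelihood zero and never exceed the
     threshold. *)
  have [S0|Sn] := eqVneq (\sum_x P x * W x y `^ a) 0.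
    rewrite big1 ?invr_ge0// => x _; rewrite /A; case: ifPn => [_|].
      by rewrite subrr.
    rewrite -ltNge => tW; rewrite subr0.
    move/eqP: S0; rewrite psumr_eq0 => [/allP/(_ x)|z _]; last first.
      by rewrite mulr_ge0// powR_ge0.
    rewrite mem_index_enum => /(_ isT)/=; rewrite mulf_eq0 => /orP[/eqP//|].
    by rewrite powR_eq0 gt_eqF// (le_lt_trans (t0 y)).
  have Sp : 0 < \sum_x P x * W x y `^ a.
    by rewrite lt_neqAle eq_sym Sn power_sum_ge0.
  rewrite -(ler_pM2r Sp) -(ler_pM2l (ltr0Sn R M.+1)).
  rewrite [leRHS]mulrA mulfV ?pnatr_eq0// mul1r mulrCA -ta mulr_suml.
  apply: ler_sum => x _; rewrite /A; case: ifPn => [_|].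
    by rewrite subrr mul0r mulr_ge0// powR_ge0.
  rewrite -ltNge => tW; rewrite subr0 ler_wpM2l//.
  by apply: ge0_ler_powR; rewrite ?nnegrE// ltW.
rewrite exchange_big/= /power_affinity mulr_sumr; apply: ler_sum => y _.
rewrite -/(t y); have -> : t y = \sum_x P x * t y by rewrite -mulr_suml P1 mul1r.
apply: ler_sum => x _.
rewrite mulrC /A; case: ifP => [Wt|_]; last by rewrite mul0r mulr_ge0.
by rewrite ler_wpM2l.
Qed.

(** As [W x y <= 1], lowering the exponent from [P x] to [A x y] only increases the product. AM-GM
    with the weights [A x y / m] then applies for each [y], and Hoelder against the constant 1
    produces the power of [#|Y|]. *)
Lemma geom_affinity_le_test (R : realType) (X Y : finType) (P : X -> R)
    (W : X -> Y -> R) (A : X -> Y -> R) (m : R) :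
  is_dist P -> is_channel W -> 0 < m < 1 -> (forall x y, 0 <= A x y <= P x) ->
  (forall y, \sum_x A x y = m) ->
  geom_affinity P W <=
  ((\sum_x \sum_y W x y * A x y) / m) `^ m * #|Y|%:R `^ (1 - m).
Proof.
move=> Pd Wc m01 AP A1; have [P0 P1] := Pd; have [W0 W1] := Wc.
have [m0 m1] := andP m01.
pose b y := \sum_x A x y / m * W x y.
have b0 y : 0 <= b y.
  rewrite sumr_ge0// => x _; rewrite mulr_ge0// divr_ge0 ?(ltW m0)//.
  by case/andP: (AP x y).
have gb y : geom_mean P W y <= b y `^ m.
  have Ad : is_dist (fun x => A x y / m).
    split => [x|]; last by rewrite -mulr_suml A1 divff// gt_eqF.
    by rewrite divr_ge0 ?(ltW m0)//; case/andP: (AP x y).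
  have := weighted_amgm Ad (fun x => W0 x y); rewrite -/(b y) => Ab.
  have -> : geom_mean P W y = (\prod_x W x y `^ (P x / m)) `^ m.
    rewrite powR_prod => [|x]; last exact: powR_ge0.
    by apply: eq_bigr => x _; rewrite -powRrM divfK// gt_eqF.
  apply: ge0_ler_powR; rewrite ?nnegrE//; first exact: ltW.
    by rewrite prodr_ge0// => x _; exact: powR_ge0.
  apply: le_trans Ab; apply: ler_prod => x _; rewrite powR_ge0/=.
  have /andP[A0 AP'] := AP x y.
  (* At [W x y = 0] the right side is 1 if [A x y = 0]; otherwise [P x] is positive too and both
     sides are 0. *)
  have [Wz|Wn] := eqVneq (W x y) 0.
    rewrite Wz; have [Az|An] := eqVneq (A x y) 0.
      rewrite Az mul0r powRr0 /powR eqxx; case: (_ == 0) => //=; exact: ler01.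
    have Pn : P x != 0.
      by rewrite gt_eqF// (lt_le_trans _ AP')// lt_neqAle eq_sym An.
    by rewrite !powR0// mulf_neq0 ?invr_neq0// gt_eqF.
  apply: ger_powR; first by rewrite lt_neqAle eq_sym Wn W0 channel_le1.
  by rewrite ler_wpM2r// invr_ge0 ltW.
apply: (@le_trans _ _ (\sum_y b y `^ m * 1 `^ (1 - m))).
  by apply: ler_sum => y _; rewrite powR1 mulr1.
apply: le_trans (hoelder_sum m01 b0 (fun=> ler01)) _.
have -> : \sum_y b y = (\sum_x \sum_y W x y * A x y) / m.
  rewrite [in RHS]exchange_big/= [RHS]mulr_suml; apply: eq_bigr => y _.
  by rewrite [RHS]mulr_suml; apply: eq_bigr => x _; rewrite mulrAC (mulrC (A x y)).
by rewrite sumr_const.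
Qed.

Lemma umlaut_fin_geom_affinity (R : realType) (X Y : finType) (P : X -> R)
    (W : X -> Y -> R) (u : R) :
  is_dist P -> is_channel W -> umlaut W = u%:E ->
  expR (- u) <= geom_affinity P W.
Proof.
move=> Pd Wc Wu; have := neglog_le_umlaut Pd Wc; rewrite Wu /neglog.
case: eqVneq => [//|Gn].
have Gp : 0 < geom_affinity P W by rewrite lt_neqAle eq_sym Gn geom_affinity_ge0.
by rewrite lee_fin lerNl => uG; rewrite -[leRHS](lnK Gp) ler_expR.
Qed.

(** Every marginal has geometric affinity at least exp (- u), so the affinity over [n] uses is at
    least exp (- n u). Comparing with [geom_affinity_le_test] at m = (M + 1) / (M + 2) and solving
    for the error leaves a penalty of order 1/M. *)
Lemma umlaut_fin_NS_error (R : realType) (X Y : finType) (W : X -> Y -> R) (u : R)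
    (n M : nat) (Z : {ffun 'I_n -> X} -> 'I_M.+2 -> {ffun 'I_n -> Y} -> 'I_M.+2 -> R)
    (y0 : Y) :
  is_channel W -> umlaut W = u%:E -> is_NS_code Z ->
  expR (- (ln 2 + n%:R * (u + (u + ln #|Y|%:R) / M.+1%:R))) <=
  NS_error (chan_pow W (n := n)) Z.
Proof.
move=> Wc Wu Zc; have Vc := is_channel_pow n Wc.
have {Wu}Wg Q Qd := @umlaut_fin_geom_affinity R X Y Q W u Qd Wc Wu.
have [P Pd [A [AP A1] ->]] := NS_code_test [ffun=> y0] Vc Zc.
set E := \sum_x _.
have Y0 : 0 < (#|Y|%:R : R) by rewrite ltr0n; apply/card_gt0P; exists y0.
have k0 : 0 < (M.+1%:R : R) by rewrite ltr0Sn.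
have k1 : 1 <= (M.+1%:R : R) by rewrite ler1n.
have kS : (M.+2%:R : R) = M.+1%:R + 1 by rewrite -natr1.
set k : R := M.+1%:R in k0 k1 kS *; clearbody k.
have kn : k != 0 by rewrite gt_eqF.
have kn1 : k + 1 != 0 by rewrite gt_eqF// addr_gt0.
have mE : 1 - M.+2%:R^-1 = k / (k + 1).
  by rewrite kS; field.
rewrite mE in A1.
have m01 : 0 < k / (k + 1) < 1.
  by rewrite divr_gt0 ?addr_gt0//= ltr_pdivrMr ?addr_gt0// mul1r ltrDl.
have [m0 m1] := andP m01.
have G1 : expR (- (n%:R * u)) <= geom_affinity P (chan_pow W (n := n)).
  rewrite geom_affinity_pow//.
  have -> : expR (- (n%:R * u)) = \prod_(i < n) expR (- u).
    by rewrite prodr_const card_ord -expRM_natl -mulrN mulr_natl.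
  apply: ler_prod => i _; rewrite expR_ge0/=.
  exact/Wg/is_dist_marginal.
have := le_trans G1 (geom_affinity_le_test Pd Vc m01 AP A1).
have E0 : 0 <= E.
  apply: sumr_ge0 => x _; apply: sumr_ge0 => y _; rewrite mulr_ge0 ?(proj1 Vc)//.
  by case/andP: (AP x y).
have [Ez|En] := eqVneq E 0.
  by rewrite -/E Ez mul0r powR0 ?gt_eqF// mul0r leNgt expR_gt0.
have Ep : 0 < E by rewrite lt_neqAle eq_sym En.
have N0 : 0 < (#|{: {ffun 'I_n -> Y}}|%:R : R).
  by rewrite ltr0n; apply/card_gt0P; exists [ffun=> y0].
have lnN : ln #|{: {ffun 'I_n -> Y}}|%:R = n%:R * ln #|Y|%:R :> R.
  by rewrite card_ffun card_ord natrX lnXn// mulr_natl.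
have Em : 0 < E / (k / (k + 1)) by rewrite divr_gt0.
rewrite -[X in _ <= X -> _]lnK ?posrE ?mulr_gt0 ?powR_gt0// ler_expR.
rewrite lnM ?posrE ?powR_gt0// !ln_powR ln_div ?posrE// lnN => H.
rewrite -[leRHS](lnK Ep) ler_expR.
(* The constant [ln 2] comes from 1/m = 1 + 1/k with k >= 1. *)
have lnm : - ln (k / (k + 1)) <= ln 2.
  rewrite -lnV ?posrE// ler_ln ?posrE ?invr_gt0// invf_div ler_pdivrMr//; lra.
have {}H : - (n%:R * u) - (1 - k / (k + 1)) * (n%:R * ln #|Y|%:R) <=
    (ln E - ln (k / (k + 1))) * (k / (k + 1)) by lra.
move: H; rewrite -ler_pdivrMr// invf_div.
have -> : (- (n%:R * u) - (1 - k / (k + 1)) * (n%:R * ln #|Y|%:R)) * ((k + 1) / k) =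
    - (n%:R * (u + (u + ln #|Y|%:R) / k)).
  by field; rewrite ?kn1 ?kn.
lra.
Qed.

Lemma negloge_eps_NS_le (R : realType) (X Y : finType) (W : X -> Y -> R) (u : R)
    (n M : nat) (P : X -> R) (y0 : Y) :
  is_channel W -> is_dist P -> umlaut W = u%:E -> (0 < n)%N ->
  (negloge n (eps_NS (chan_pow W (n := n)) M.+2) <=
   (ln 2 / n%:R + u + (u + ln #|Y|%:R) / M.+1%:R)%:E)%E.
Proof.
move=> Wc Pd Wu n0; have Vc := is_channel_pow n Wc.
have nR : 0 < (n%:R : R) by rewrite ltr0n.
have eb : expR (- (ln 2 + n%:R * (u + (u + ln #|Y|%:R) / M.+1%:R))) <=
    eps_NS (chan_pow W (n := n)) M.+2.
  apply: (eps_NS_ge Vc (is_dist_pow n Pd)) => Z Zc.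
  exact: umlaut_fin_NS_error.
have e0 := lt_le_trans (expR_gt0 _) eb.
rewrite /negloge gt_eqF// lee_fin ler_pdivrMr// lerNl.
rewrite -[leLHS]expRK ler_ln ?posrE ?expR_gt0//.
apply: le_trans eb; rewrite ler_expR lerN2 le_eqVlt; apply/orP; left; apply/eqP.
by rewrite !mulrDl divfK ?gt_eqF//; ring.
Qed.

Lemma negloge_eps_NS_ge (R : realType) (X Y : finType) (W : X -> Y -> R) (a : R)
    (n M : nat) (P : X -> R) (y0 : Y) :
  is_channel W -> is_dist P -> 0 < a -> (0 < n)%N ->
  ((- ln (power_affinity a P W) - ln M.+2%:R / a / n%:R)%:E <=
   negloge n (eps_NS (chan_pow W (n := n)) M.+2))%E.
Proof.
move=> Wc Pd a0 n0; have Vc := is_channel_pow n Wc.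
have Pnd := is_dist_pow n Pd.
have nR : 0 < (n%:R : R) by rewrite ltr0n.
rewrite /negloge; case: ifPn => [_|en]; first exact: leey.
have ep : 0 < eps_NS (chan_pow W (n := n)) M.+2.
  by rewrite lt_neqAle eq_sym en (eps_NS_ge0 M [ffun=> y0] Vc Pnd).
have := eps_NS_le_power_affinity M [ffun=> y0] a0 Pnd Vc.
rewrite power_affinity_pow//; have gp := power_affinity_gt0 a Pd Wc.
rewrite -ler_ln ?posrE ?mulr_gt0 ?exprn_gt0 ?powR_gt0 ?ltr0Sn//.
rewrite lnM ?posrE ?exprn_gt0 ?powR_gt0 ?ltr0Sn// ln_powR lnXn// => H.
rewrite lee_fin ler_pdivlMr// mulrBl divfK ?gt_eqF// mulrC.
by move: H; rewrite -mulr_natl; lra.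
Qed.

(** * Error exponents *)

Lemma limn_einfE (R : realType) (u : nat -> \bar R) :
  limn_einf u = limf_einf u \oo.
Proof. by []. Qed.

Lemma near_div_natr_le (R : realType) (K e : R) : 0 < e ->
  \forall n \near \oo, (0 < n)%N /\ K / n%:R <= e.
Proof.
move=> e0; near=> n; have n0 : (0 < n)%N by near: n; exact: nbhs_infty_gt.
split=> //; rewrite ler_pdivrMr ?ltr0n// mulrC -ler_pdivrMr//.
by near: n; exact: nbhs_infty_ger.
Unshelve. all: by end_near. Qed.

(** With [1 < x] there are at least two messages, the form in which the code bounds are stated. The
    factor 2 costs a [ln 2] that vanishes after division by the block length. *)
Lemma absz_ceil_bounds (R : realType) (x : R) : 1 < x ->
  exists M, absz (Num.ceil x) = M.+2 /\ x <= M.+2%:R <= 2 * x.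
Proof.
move=> x1; have c0 : (0 <= Num.ceil x)%R by rewrite ceil_ge0; lra.
have cx : (absz (Num.ceil x))%:R = (Num.ceil x)%:~R :> R.
  by rewrite -[in RHS](gez0_abs c0).
have xc : x <= (absz (Num.ceil x))%:R by rewrite cx ceil_ge.
have cx1 : (absz (Num.ceil x))%:R < x + 1.
  by rewrite cx -ltrBlDr -[X in _ - X]/(1%:~R) -intrB gt_pred_ceil.
case: (absz _) xc cx1 => [|[|M]] xc cx1.
- by move: xc; rewrite mulr0n; lra.
- by move: xc; rewrite mulr1n; lra.
- by exists M; split=> //; apply/andP; split; lra.
Qed.

Lemma channel_output (R : realType) (X Y : finType) (W : X -> Y -> R) :
  (0 < #|X|)%N -> is_channel W -> (0 < #|Y|)%N.
Proof.
move=> /card_gt0P[x _] [W0 W1].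
by have [y _] := @dist_support R Y (W x) (conj (W0 x) (W1 x)); apply/card_gt0P; exists y.
Qed.

Lemma ex_dist (R : realType) (X : finType) :
  (0 < #|X|)%N -> exists P : X -> R, is_dist P.
Proof.
move=> X0; have /card_gt0P[x0 _] := X0; exists (fun x => (x == x0)%:R); split => [x|].
  exact: ler0n.
by rewrite (bigD1 x0)//= big1 ?eqxx ?addr0// => x /negbTE ->.
Qed.

Lemma ENS_ge (R : realType) (X Y : finType) (W : X -> Y -> R)
    (a r c : R) (P : X -> R) :
  (0 < #|X|)%N -> is_channel W -> 0 < a -> 0 < r -> is_dist P ->
  c < - ln (power_affinity a P W) - r / a -> (c%:E <= ENS W r)%E.
Proof.
move=> X0 Wc a0 r0 Pd cr; have /card_gt0P[y0 _] := channel_output X0 Wc.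
have e0 : 0 < - ln (power_affinity a P W) - r / a - c by rewrite subr_gt0.
rewrite /ENS limn_einfE; apply: limf_einf_ge => /=.
apply: filterS (near_div_natr_le (ln 2 / a) e0) => n [n0 ne] /=.
have nR : 0 < (n%:R : R) by rewrite ltr0n.
have rn : 0 < r * n%:R by rewrite mulr_gt0.
have x1 : 1 < expR (r * n%:R) by rewrite expR_gt1.
have [M [-> /andP[M1 M2]]] := absz_ceil_bounds x1.
apply: le_trans (negloge_eps_NS_ge M y0 Wc Pd a0 n0).
have lM : ln M.+2%:R <= ln 2 + r * n%:R.
  rewrite -[X in _ + X]expRK -lnM ?posrE ?expR_gt0//.
  by rewrite ler_ln ?posrE ?mulr_gt0 ?expR_gt0 ?ltr0Sn.
have {}lM : ln M.+2%:R / a / n%:R <= (ln 2 + r * n%:R) / a / n%:R.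
  by rewrite !ler_pM2r ?invr_gt0.
have E : (ln 2 + r * n%:R) / a / n%:R = ln 2 / a / n%:R + r / a.
  by field; rewrite !gt_eqF.
rewrite lee_fin; lra.
Qed.

Lemma ENS_0_ge (R : realType) (X Y : finType) (W : X -> Y -> R)
    (a c : R) (P : X -> R) :
  (0 < #|X|)%N -> is_channel W -> 0 < a -> is_dist P ->
  c < - ln (power_affinity a P W) -> (c%:E <= ENS_0 W)%E.
Proof.
move=> X0 Wc a0 Pd ca; have /card_gt0P[y0 _] := channel_output X0 Wc.
rewrite /ENS_0 limn_einfE; apply: limf_einf_ge => /=.
apply: filterS (nbhs_infty_ge 2) => -[|[|M]]//= _.
have e0 : 0 < - ln (power_affinity a P W) - c by rewrite subr_gt0.
rewrite limn_einfE; apply: limf_einf_ge => /=.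
apply: filterS (near_div_natr_le (ln M.+2%:R / a) e0) => n [n0 ne] /=.
apply: le_trans (negloge_eps_NS_ge M y0 Wc Pd a0 n0).
rewrite lee_fin; lra.
Qed.

(** Sign of the coefficient of the 1/M penalty, so that the number of messages may be replaced by a
    lower bound. *)
Lemma umlaut_fin_slack (R : realType) (X Y : finType) (W : X -> Y -> R) (u : R) :
  (0 < #|X|)%N -> is_channel W -> umlaut W = u%:E -> 0 <= u + ln #|Y|%:R.
Proof.
move=> X0 Wc Wu; have /card_gt0P[y0 _] := channel_output X0 Wc.
have := umlaut_ge0 X0 Wc; rewrite Wu lee_fin => u0.
by rewrite addr_ge0// ln_ge0// ler1n; apply/card_gt0P; exists y0.
Qed.

Lemma ENS_le_umlaut (R : realType) (X Y : finType) (W : X -> Y -> R) (r : R) :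
  (0 < #|X|)%N -> is_channel W -> 0 < r -> (ENS W r <= umlaut W)%E.
Proof.
move=> X0 Wc r0; have /card_gt0P[y0 _] := channel_output X0 Wc; have [P Pd] := @ex_dist R X X0.
case Wu : (umlaut W) => [u| |]; last 2 first.
- exact: leey.
- by have := umlaut_ge0 X0 Wc; rewrite Wu.
have K0 := umlaut_fin_slack X0 Wc Wu.
rewrite /ENS limn_einfE; apply: limf_einf_le => e e0.
have near_e := near_div_natr_le (ln 2 + (u + ln #|Y|%:R) / r) e0.
apply: filterS near_e => n [n0 ne] /=.
have nR : 0 < (n%:R : R) by rewrite ltr0n.
have rn : 0 < r * n%:R by rewrite mulr_gt0.
have x1 : 1 < expR (r * n%:R) by rewrite expR_gt1.
have [M [-> /andP[M1 _]]] := absz_ceil_bounds x1.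
apply: le_trans (negloge_eps_NS_le M y0 Wc Pd Wu n0) _.
(* Linear growth suffices: exp t >= 1 + t absorbs the shift from [M.+2] to [M.+1]. *)
have Mrn : r * n%:R <= M.+1%:R.
  have := expR_ge1Dx (r * n%:R); have : (M.+2%:R : R) = M.+1%:R + 1 by rewrite -natr1.
  clear Wu; lra.
have : (u + ln #|Y|%:R) / M.+1%:R <= (u + ln #|Y|%:R) / r / n%:R.
  by rewrite -mulrA -invfM ler_wpM2l// lef_pV2 ?posrE// mulrC.
have : ln 2 / n%:R + (u + ln #|Y|%:R) / r / n%:R <= e by rewrite -mulrDl.
rewrite lee_fin => H1 H2; rewrite addrAC addrC lerD2l.
apply: le_trans H1; exact: lerD.
Qed.

Lemma ENS_0_le_umlaut (R : realType) (X Y : finType) (W : X -> Y -> R) :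
  (0 < #|X|)%N -> is_channel W -> (ENS_0 W <= umlaut W)%E.
Proof.
move=> X0 Wc; have /card_gt0P[y0 _] := channel_output X0 Wc; have [P Pd] := @ex_dist R X X0.
case Wu : (umlaut W) => [u| |]; last 2 first.
- exact: leey.
- by have := umlaut_ge0 X0 Wc; rewrite Wu.
have K0 := umlaut_fin_slack X0 Wc Wu.
rewrite /ENS_0 limn_einfE; apply: limf_einf_le => e e0.
(* The factor 2 comes from 1/(M + 1) <= 2/(M + 2). *)
have near_e := near_div_natr_le ((u + ln #|Y|%:R) * 2) e0.
apply: filterS2 (nbhs_infty_ge 2) near_e => -[|[|M]]//= _ [_ Me].
rewrite limn_einfE; apply: limf_einf_le => d d0.
apply: filterS (near_div_natr_le (ln 2) d0) => n [n0 ne] /=.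
apply: le_trans (negloge_eps_NS_le M y0 Wc Pd Wu n0) _.
have : (u + ln #|Y|%:R) / M.+1%:R <= (u + ln #|Y|%:R) * 2 / M.+2%:R.
  rewrite -mulrA ler_wpM2l// ler_pdivlMr ?ltr0Sn// mulrC ler_pdivrMr ?ltr0Sn//.
  by rewrite -natrM ler_nat; lia.
rewrite lee_fin => H; rewrite -addrA (addrC (u + e)) lerD// lerD2l.
exact: le_trans H Me.
Qed.

Lemma ENS_0_umlaut (R : realType) (X Y : finType) (W : X -> Y -> R) :
  (0 < #|X|)%N -> is_channel W -> ENS_0 W = umlaut W.
Proof.
move=> X0 Wc; apply/eqP; rewrite eq_le ENS_0_le_umlaut//=; apply: lee_lt_fin => c cU.
have [s /andP[s0 _] [P Pd cP]] := lt_umlaut_power_affinity Wc cU.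
exact: ENS_0_ge X0 Wc s0 Pd cP.
Qed.

Lemma ENS0p_umlaut (R : realType) (X Y : finType) (W : X -> Y -> R) :
  (0 < #|X|)%N -> is_channel W -> ENS0p W = umlaut W.
Proof.
move=> X0 Wc; apply/eqP; rewrite eq_le; apply/andP; split.
  case Wu : (umlaut W) => [u| |]; last 2 first.
  - exact: leey.
  - by have := umlaut_ge0 X0 Wc; rewrite Wu.
  apply: limf_einf_le => e e0; near=> r => /=.
  apply: (@le_trans _ _ (umlaut W)); first exact: ENS_le_umlaut.
  by rewrite Wu lee_fin lerDl ltW.
apply: lee_lt_fin => c cU.
(* Order and input are chosen before the rate, which is then taken below [s] times the remaining
   gap. *)
have [s /andP[s0 _] [P Pd cP]] := lt_umlaut_power_affinity Wc cU.
apply: limf_einf_ge; near=> r => /=; apply: (ENS_ge X0 Wc s0 _ Pd) => //.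
rewrite ltrBrDr -ltrBrDl ltr_pdivrMr//.
by near: r; apply: nbhs_right_lt; rewrite mulr_gt0// subr_gt0.
Unshelve. all: by end_near. Qed.

Theorem mainTheorem1 (R : realType) (X Y : finType) (W : X -> Y -> R) :
  (0 < #|X|)%N -> is_channel W ->
  ENS_0 W = ENS0p W /\ ENS0p W = umlaut W /\
  (Esp W r @[r --> 0^'+] --> umlaut W).
Proof.
move=> X0 Wc; rewrite ENS_0_umlaut// ENS0p_umlaut//.
by split=> //; split=> //; exact: cvg_Esp_umlaut.
Qed.
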